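(* Every ČF$T_2$ fuzzy closure space is ČF$T_1$.
   Context: $I=[0,1]$; a fuzzy (sub)set of a non-empty set $X$ is a map $f:X\to I$, and $I^X$ is the set of all of them, ordered pointwise, with $\vee,\wedge$ pointwise supremum/infimum. $\underline 0$ is the constant $0$ fuzzy set; the complement is $\mathfrak{Co}(f)(x)=1-f(x)$. For $x\in X$ and $0<\lambda\le1$, the fuzzy point $x_\lambda$ has value $\lambda$ at $x$ and $0$ elsewhere; $x_\lambda\in f$ means $x_\lambda\le f$, i.e. $\lambda\le f(x)$. Fuzzy points $x_\lambda,y_\gamma$ are distinct if $x\ne y$. A fuzzy closure space is a pair $(X,c)$ with $X$ a non-empty set and $c:I^X\to I^X$ satisfying $c(\underline 0)=\underline 0$, $f\le c(f)$, and $c(f\vee g)=c(f)\vee c(g)$ for all $f,g\in I^X$ (idempotency is not required). The interior is $\operatorname{int}(f)=\mathfrak{Co}(c(\mathfrak{Co}(f)))$; $f$ is a neighborhood of a fuzzy point $x_\lambda$ if $x_\lambda\le\operatorname{int}(f)$. $(X,c)$ is ČF$T_1$ if for every two distinct fuzzy points $x_\lambda,y_\gamma$ of $X$, both $x_\lambda\in\mathfrak{Co}(c(y_\gamma))$ and $y_\gamma\in\mathfrak{Co}(c(x_\lambda))$. $(X,c)$ is ČF$T_2$ if for every two distinct fuzzy points $x_\lambda,y_\gamma$ there are neighborhoods $f$ of $x_\lambda$ and $g$ of $y_\gamma$ such that $f\le\mathfrak{Co}(g)$, $x_\lambda\in f\le\mathfrak{Co}(y_\gamma)$ and $y_\gamma\in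 g\le\mathfrak{Co}(x_\lambda)$. *)

(* Defs.v *)
From HB Require Import structures.
From mathcomp Require Import all_boot all_order all_algebra.
From mathcomp Require Import interval_inference boolp reals.

Set Implicit Arguments.
Unset Strict Implicit.
Unset Printing Implicit Defensive.

Import Order.TTheory GRing.Theory Num.Theory.

Local Open Scope ring_scope.
Local Open Scope order_scope.

(* The order and the lattice operations on fuzzy sets are the pointwise ones
   of [boolp.FunOrder]: see [lefP], [joinfE] and [meetfE]. *)
Notation fuzzy_set R X := (X -> {i01 R})%type.

Section FuzzySets.
Variables (R : realType) (X : Type).
Implicit Types (f : fuzzy_set R X) (x : X) (l : {i01 R}).

Definition fuzzy0 : fuzzy_set R X := fun=> 0%:i01.

Definition fuzzyC f : fuzzy_set R X := fun x => (1 - (f x)%:num)%:i01.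

(* This is a fuzzy point only when [0 < l]. *)
Definition fuzzy_point x l : fuzzy_set R X :=
  fun y => if `[< y = x >] then l else 0%:i01.

End FuzzySets.

Arguments fuzzy0 {R X}.

Record fuzzyClosureSpace (R : realType) := FuzzyClosureSpace {
  carrier :> Type;
  carrier_inhabited : inhabited carrier;
  cl : fuzzy_set R carrier -> fuzzy_set R carrier;
  cl0 : cl fuzzy0 = fuzzy0;
  cl_ge : forall f : fuzzy_set R carrier, f <= cl f;
  clU : forall f g : fuzzy_set R carrier, cl (f `|` g) = cl f `|` cl g
}.

Section Separation.
Variables (R : realType) (X : fuzzyClosureSpace R).
Implicit Types (f g : fuzzy_set R X) (x y : X) (l m : {i01 R}).

Definition fuzzy_int f : fuzzy_set R X := fuzzyC (cl (fuzzyC f)).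

Definition fuzzy_nbhd x l f : Prop := fuzzy_point x l <= fuzzy_int f.

Definition CFT1 : Prop :=
  forall x y l m, x <> y -> 0%:i01 < l -> 0%:i01 < m ->
    fuzzy_point x l <= fuzzyC (cl (fuzzy_point y m)) /\
    fuzzy_point y m <= fuzzyC (cl (fuzzy_point x l)).

Definition CFT2 : Prop :=
  forall x y l m, x <> y -> 0%:i01 < l -> 0%:i01 < m ->
    exists f g,
      [/\ fuzzy_nbhd x l f, fuzzy_nbhd y m g, f <= fuzzyC g,
          fuzzy_point x l <= f <= fuzzyC (fuzzy_point y m) &
          fuzzy_point y m <= g <= fuzzyC (fuzzy_point x l)].

End Separation.

(* Main.v *)
(** If [f] is a neighborhood of [x_l] with [f <= Co y_m], then [y_m <= Co f], so
    monotonicity of the closure operator gives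
    [x_l <= int f = Co (c (Co f)) <= Co (c y_m)]. *)

Require Import Defs.
From mathcomp Require Import all_boot all_order all_algebra.
From mathcomp Require Import interval_inference boolp reals.

Import Order.TTheory GRing.Theory Num.Theory.

Local Open Scope order_scope.

(** Complement is an order-reversing involution and additivity makes [cl] monotone, so a set lying
    under the complement of [g] has its interior under the complement of [cl g]
    ([fuzzy_int_le_fuzzyC_cl]). Each of the two separating neighborhoods is used with [g] the
    opposite fuzzy point. *)

Section FuzzyComplement.
Variables (R : realType) (X : Type).
Implicit Types f g : fuzzy_set R X.

Lemma le_fuzzyC f g : f <= g -> fuzzyC g <= fuzzyC f.
Proof.
move=> /lefP fg; apply/lefP => x.
by rewrite -num_le /= lerB // num_le; exact: fg.
Qed.

Lemma fuzzyCK f : fuzzyC (fuzzyC f) = f.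
Proof. by apply/funext => x; apply/val_inj; rewrite /= subKr. Qed.

Lemma le_fuzzyC_swap f g : f <= fuzzyC g -> g <= fuzzyC f.
Proof. by move=> /le_fuzzyC; rewrite fuzzyCK. Qed.

End FuzzyComplement.

Section Closure.
Variables (R : realType) (X : fuzzyClosureSpace R).
Implicit Types f g : fuzzy_set R X.

(** Monotonicity comes from additivity: if [f <= g], then [g] is the join of [g] and [f], so [cl g]
    is a join with [cl f]. *)
Lemma le_cl f g : f <= g -> cl f <= cl g.
Proof. by move=> /join_idPl <-; rewrite clU leUr. Qed.

Lemma fuzzy_int_le_fuzzyC_cl f g : f <= fuzzyC g -> fuzzy_int f <= fuzzyC (cl g).
Proof. by move=> /le_fuzzyC_swap/le_cl/le_fuzzyC. Qed.

End Closure.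

Theorem theorem6p2 (R : realType) (X : fuzzyClosureSpace R) :
  CFT2 X -> CFT1 X.
Proof.
move=> T2 x y l m xy l0 m0.
have [f [g [xf yg _ /andP[_ fy] /andP[_ gx]]]] := T2 x y l m xy l0 m0.
(* The middle terms are the interiors of [f] and [g]. *)
split; [apply: le_trans xf _ | apply: le_trans yg _];
  exact: fuzzy_int_le_fuzzyC_cl.
Qed.
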